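(* Let $k$ be a field and $G$ a finite group, and let $n\ge1$. For each conjugacy class $C_x$ of $G$, the operator $\bigtriangleup:\mathcal{H}^n\to\mathcal{H}^{n-1}$ restricts to an operator $\bigtriangleup_x:\mathcal{H}_x^n\to\mathcal{H}_x^{n-1}$; that is, $\bigtriangleup(\mathcal{H}_x^n)\subseteq\mathcal{H}_x^{n-1}$.
   Context: Write $\overline{G}=G\setminus\{1\}$. $\mathcal{H}^n=\mathrm{Map}(\overline{G}^{\times n},kG)$ (with $\mathcal{H}^0=kG$) is the space of normalized Hochschild $n$-cochains of $kG$, identified with $\mathrm{Hom}_k((kG/k\cdot 1)^{\otimes n},kG)$; accordingly, in every formula a cochain takes the value $0$ whenever one of its arguments equals $1$. For $x\in G$ with conjugacy class $C_x$, $\mathcal{H}_x^0=kC_x$ and, for $n\ge1$, $\mathcal{H}_x^n$ is the space of maps $\varphi:\overline{G}^{\times n}\to kG$ such that $\varphi(g_1,\dots,g_n)$ lies in the $k$-span of the set $g_1\cdots g_nC_x$ for all $g_1,\dots,g_n\in\overline{G}$. Let $\langle\ ,\ \rangle:kG\times kG\to k$ be the bilinear form with $\langle g,h\rangle=1$ if $g=h^{-1}$ and $0$ otherwise ($g,h\in G$). For $n\ge1$ the operator $\bigtriangleup:\mathcal{H}^n\to\mathcal{H}^{n-1}$ is $$\bigtriangleup(\varphi)(g_1,\dots,g_{n-1})=\sum_{g_n\in G}\sum_{i=1}^n(-1)^{i(n-1)}\langle\varphi(g_i,\dots,g_{n-1},g_n,g_1,\dots,g_{i-1}),1\rangle\,g_n^{-1}.$$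 *)

(* Defs.v *)
From HB Require Import structures.
From mathcomp Require Import all_boot all_order all_algebra all_fingroup.

Set Implicit Arguments.
Unset Strict Implicit.
Unset Printing Implicit Defensive.

Import GRing.Theory.
Local Open Scope ring_scope.

(* The group algebra kG as a k-vector space: a is \sum_g a(g) g. The regular   *)
(* module k^o is what makes this type a vectType.                              *)
Notation group_alg k gT := {ffun gT -> k^o}.

(* The basis element of kG given by g in G. *)
Definition kgen (k : fieldType) (gT : finGroupType) (g : gT) : group_alg k gT :=
  [ffun h => (h == g)%:R].

(* Bilinear extension of <g, h> = 1 if g = h^-1 and 0 otherwise. *)
Definition kform (k : fieldType) (gT : finGroupType) (a b : group_alg k gT) : k :=
  \sum_(g : gT) \sum_(h : gT) a g * b h * (g == h^-1%g)%:R.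

Definition kspan (k : fieldType) (gT : finGroupType) (A : {set gT}) :
    {vspace group_alg k gT} :=
  <<[seq kgen k g | g in A]>>%VS.

Notation nontrivial gT := {g : gT | g != 1%g}.

(* Normalized cochains. For n = 0 the domain is the one-point type of empty    *)
(* tuples, so that [cochain k gT 0] is kG via evaluation at [tuple].           *)
Notation cochain k gT n := {ffun n.-tuple (nontrivial gT) -> group_alg k gT}.

(* The value of a cochain at arbitrary arguments: 0 as soon as one of them     *)
(* is 1, in which case no tuple of nontrivial elements lies over s.            *)
Definition cochain_ext (k : fieldType) (gT : finGroupType) (n : nat)
    (phi : cochain k gT n) (s : n.-tuple gT) : group_alg k gT :=
  if [pick t : n.-tuple (nontrivial gT) | map_tuple val t == s] is Some t
  then phi t else 0.

(* The space H_x^n. For n = 0 the product is empty, and the condition says     *)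
(* that the single value of phi lies in the span of the class of x.            *)
Definition class_cochain (k : fieldType) (gT : finGroupType) (x : gT) (n : nat) :
    {pred cochain k gT n} :=
  [pred phi : cochain k gT n |
    [forall t, phi t \in
       kspan k ((\prod_(g <- t) val g)%g *: (x ^: [set: gT]))%g]].
Arguments class_cochain k {gT} x n _.

(* The operator from (n+1)-cochains to n-cochains. The index i is shifted by   *)
(* one with respect to 1 <= i <= n+1, so that i.+1 occurs in the sign and the  *)
(* arguments (g_1, ..., g_n, h) are rotated by i places.                       *)
Definition BV_op (k : fieldType) (gT : finGroupType) (n : nat)
    (phi : cochain k gT n.+1) : cochain k gT n :=
  [ffun t : n.-tuple (nontrivial gT) =>
    \sum_(h : gT) \sum_(i < n.+1)
      ((-1) ^+ (i.+1 * n)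
         * kform (cochain_ext phi (rot_tuple i (rcons_tuple (map_tuple val t) h)))
                 (kgen k 1%g))
      *: kgen k h^-1%g].

(* Main.v *)
(** The coefficient of [h^-1] in the value of the operator at [(g_1, ..., g_n)]
    is a signed sum of the coefficients of [1] in the values of [phi] at the
    rotations of [(g_1, ..., g_n, h)].  If one of these is nonzero, the product
    of the rotated arguments is inverse to an element of the class of [x].
    Rotating the factors of a product conjugates it, so [(g_1 ... g_n h)^-1]
    and its conjugate [(g_1 ... g_n)^-1 h^-1] also lie in that class. *)

Require Import Defs.
From mathcomp Require Import all_boot all_order all_algebra all_fingroup.

Import GRing.Theory.

Lemma kform_1r (k : fieldType) (gT : finGroupType) (a : group_alg k gT) :
  kform a (kgen k 1%g) = a 1%g.
Proof.
rewrite /kform (bigD1 1%g) //= (bigD1 1%g) //= ffunE !eqxx invg1 eqxx !mulr1.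
rewrite big1 => [|h /negPf h1]; last by rewrite ffunE h1 mulr0 mul0r.
rewrite addr0 big1 ?addr0 // => g /negPf g1.
rewrite big1 // => h _; rewrite ffunE.
by case: eqP => [->|_]; rewrite ?invg1 ?g1 ?mulr0 ?mul0r.
Qed.

(** Each generator [kgen k h] with [h] in [A] vanishes at every point outside [A], hence so does any
    linear combination. *)
Lemma mem_kspan_coef (k : fieldType) (gT : finGroupType) (A : {set gT})
    (a : group_alg k gT) (g : gT) :
  a \in kspan k A -> a g != 0%R -> g \in A.
Proof.
rewrite /kspan -[X in <<X>>%VS]in_tupleE => /coord_span ->.
apply: contraR => gA; rewrite sum_ffunE big1 // => i _.
rewrite ffunE (_ : _ g = 0%R) ?scaler0 //.
have /imageP[h hA ->] := mem_nth 0%R (ltn_ord i).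
by rewrite ffunE; case: eqP gA => // ->; rewrite hA.
Qed.

Lemma kgen_mem_kspan (k : fieldType) (gT : finGroupType) (A : {set gT})
    (g : gT) : g \in A -> kgen k g \in kspan k A.
Proof. by move=> gA; apply/memv_span/image_f. Qed.

Lemma cochain_ext_mem (k : fieldType) (gT : finGroupType) (x : gT) (n : nat)
    (phi : cochain k gT n) (s : n.-tuple gT) :
  phi \in class_cochain k x n ->
  cochain_ext phi s \in
    kspan k ((\prod_(g <- s) g)%g *: (x ^: [set: gT]))%g.
Proof.
move=> /forallP phiP; rewrite /cochain_ext.
(* The default value 0 lies in every span. *)
case: pickP => [t /eqP <-|_]; last exact: mem0v.
by rewrite big_map.
Qed.

(** With p the product over [take i s] and q that over [drop i s], q p = p^-1 (p q) p. *)
Lemma prod_rot (gT : finGroupType) (i : nat) (s : seq gT) :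
  (\prod_(g <- rot i s) g = (\prod_(g <- s) g) ^ \prod_(g <- take i s) g)%g.
Proof.
by rewrite -[in X in (X ^ _)%g](cat_take_drop i s) /rot !big_cat conjgE /= -mulgA mulKg.
Qed.

Theorem lemma8p1 (k : fieldType) (gT : finGroupType) (n : nat) (x : gT)
    (phi : cochain k gT n.+1) :
  phi \in class_cochain k x n.+1 -> BV_op phi \in class_cochain k x n.
Proof.
move=> phiP; apply/forallP => t; rewrite ffunE.
apply: memv_suml => h _; apply: memv_suml => i _; rewrite kform_1r.
set s := rot_tuple i _.
have [->|nz] := eqVneq (cochain_ext phi s 1%g) 0%R.
  by rewrite mulr0 scale0r mem0v.
apply/memvZ/kgen_mem_kspan.
have := mem_kspan_coef _ _ _ _ _ (cochain_ext_mem _ _ _ _ _ s phiP) nz.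
rewrite !mem_lcoset mulg1 /= prod_rot big_rcons /= big_map -conjVg.
rewrite memJ_norm ?(subsetP (class_norm _ _)) ?inE //.
(* With P the product over [t], conjugating (P h)^-1 = h^-1 P^-1 by [h^-1] gives P^-1 h^-1. *)
rewrite -(memJ_norm _ (_ : (h^-1)%g \in 'N(x ^: [set: gT])%g)); last first.
  by rewrite (subsetP (class_norm _ _)) ?inE.
by rewrite invMg conjgE invgK !mulgA mulgV mul1g.
Qed.
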